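(* Let $F_1$ and $F_2$ be two square-integrable graph root distributions on $\mathcal K$. For $i=1,2$ let $Z_i:[0,1]\to\mathcal K$ be an inverse transform sampling mapping of $F_i$ and let $W_i(s,s')=\langle Z_i(s),Z_i(s')\rangle_{\mathcal K}$ be the corresponding graphon. Then $$\delta_\square(W_1,W_2)\le\left(\mathbb E_{Z\sim F_1}\|Z\|+\mathbb E_{Z\sim F_2}\|Z\|\right)d_{\rm w}(F_1,F_2).$$
   Context: Krein space: $\mathcal H_+=\mathcal H_-=\{x\in\mathbb R^\infty:\sum_j x_j^2<\infty\}$ with the usual inner product, and $\mathcal K=\mathcal H_+\ominus\mathcal H_-$ is the set of pairs $(x,y)$, $x\in\mathcal H_+$, $y\in\mathcal H_-$, with indefinite inner product $\langle(x,y),(x',y')\rangle_{\mathcal K}=\langle x,x'\rangle_{\mathcal H_+}-\langle y,y'\rangle_{\mathcal H_-}$, norm $\|(x,y)\|=(\|x\|^2+\|y\|^2)^{1/2}$, and its Borel $\sigma$-field. Graph root distribution (GRD): a Borel probability measure $F$ on $\mathcal K$ such that $\mathbb P(\langle Z_1,Z_2\rangle_{\mathcal K}\in[0,1])=1$ for independent $Z_1,Z_2\sim F$; square-integrable means $\mathbb E_{Z\sim F}\|Z\|^2<\infty$. Inverse transform sampling mapping (ITS) of $F$: a measurable $Z:[0,1]\to\mathcal K$ such that $Z(s)\sim F$ when $s$ is uniform on $[0,1]$. The function $W_i$ above is symmetric and takes values in $[0,1]$ almost everywhere. Cut-distance: $\delta_\square(W_1,W_2)=\inf_{h_1,h_2}\sup_{S,S'\subseteq[0,1]}\left|\int_{S\times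 S'}[W_1(h_1(s),h_1(s'))-W_2(h_2(s),h_2(s'))]\,ds\,ds'\right|$, where $h_1,h_2$ range over Lebesgue-measure-preserving maps $[0,1]\to[0,1]$ and $S,S'$ over measurable sets. Wasserstein distance: $d_{\rm w}(F_1,F_2)=\inf_{\nu\in\mathcal V(F_1,F_2)}\mathbb E_{(Z_1,Z_2)\sim\nu}\|Z_1-Z_2\|$, where $\mathcal V(F_1,F_2)$ is the set of all distributions on $\mathcal K\times\mathcal K$ with marginals $F_1$ and $F_2$. *)

(* Defs.v *)
From HB Require Import structures.
From mathcomp Require Import all_boot all_order all_algebra.
From mathcomp Require Import all_classical all_reals all_analysis.
From mathcomp Require Import ring.

Set Implicit Arguments.
Unset Strict Implicit.
Unset Printing Implicit Defensive.

Import Order.TTheory GRing.Theory Num.Theory.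
Import numFieldNormedType.Exports.
Local Open Scope classical_set_scope.
Local Open Scope ring_scope.

Definition square_summable (R : realType) : {pred nat -> R} :=
  fun x => `[< cvgn (series (fun j => x j ^+ 2)) >].

Lemma square_summableP (R : realType) (x : nat -> R) :
  reflect (cvgn (series (fun j => x j ^+ 2))) (x \in @square_summable R).
Proof. exact: asboolP. Qed.

Lemma cvg_series_mul (R : realType) (x y : nat -> R) :
  x \in @square_summable R -> y \in @square_summable R ->
  cvgn (series (fun j => x j * y j)).
Proof.
move=> /square_summableP cx /square_summableP cy.
apply: (@normed_cvg R R).
apply: (@series_le_cvg R _ (fun j => x j ^+ 2 + y j ^+ 2)).
- by move=> n; exact: normr_ge0.
- by move=> n; rewrite addr_ge0 ?sqr_ge0.
- move=> n /=; rewrite normrM -(real_normK (num_real (x n))).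
  rewrite -(real_normK (num_real (y n))).
  have := sqr_ge0 (`|x n| - `|y n|); rewrite sqrrB addrAC subr_ge0.
  by apply: le_trans; rewrite mulr2n lerDl mulr_ge0.
- exact: is_cvg_seriesD.
Qed.

Lemma square_summable_submod (R : realType) :
  submod_closed (@square_summable R).
Proof.
split.
  apply/square_summableP.
  rewrite (_ : series _ = cst 0); first exact: is_cvg_cst.
  by apply/funext => n; rewrite seriesEnat/= big1// => j _; rewrite expr0n.
move=> a x y xs ys; apply/square_summableP.
rewrite (_ : (fun j => _) = (a ^+ 2 *: (fun j => x j ^+ 2) +
   (a * 2) *: (fun j => x j * y j) + (fun j => y j ^+ 2))).
  apply: is_cvg_seriesD; last exact/square_summableP.
  apply: is_cvg_seriesD; apply: is_cvg_seriesZ; first exact/square_summableP.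
  exact: cvg_series_mul.
apply/funext => j.
change ((a * x j + y j) ^+ 2 =
  a ^+ 2 * x j ^+ 2 + a * 2 * (x j * y j) + y j ^+ 2).
by ring.
Qed.

HB.instance Definition _ (R : realType) :=
  GRing.isSubmodClosed.Build R (nat -> R) (@square_summable R)
    (@square_summable_submod R).

Record l2 (R : realType) := L2 {
  l2val :> nat -> R ;
  l2valP : l2val \in @square_summable R }.

HB.instance Definition _ (R : realType) := [isSub for @l2val R].
HB.instance Definition _ (R : realType) := [Choice of l2 R by <:].
HB.instance Definition _ (R : realType) :=
  [SubChoice_isSubLmodule of l2 R by <:].

Section l2_dot.
Context {R : realType}.
Implicit Types (x y z : l2 R) (a : R).

Definition l2_dot x y : R := limn (series (fun j => x j * y j)).

Definition l2_norm x : R := Num.sqrt (l2_dot x x).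

Lemma l2_dotC x y : l2_dot x y = l2_dot y x.
Proof. by congr (limn (series _)); apply/funext => j; rewrite mulrC. Qed.

Lemma l2_dotDl x y z : l2_dot (x + y) z = l2_dot x z + l2_dot y z.
Proof.
rewrite /l2_dot -lim_seriesD; [|exact: cvg_series_mul (l2valP _) (l2valP _)..].
by congr (limn (series _)); apply/funext => j; rewrite /= mulrDl.
Qed.

Lemma l2_dotZl a x y : l2_dot (a *: x) y = a * l2_dot x y.
Proof.
rewrite /l2_dot -[RHS](@lim_seriesZ _ (fun j => x j * y j) a);
  last exact: cvg_series_mul (l2valP _) (l2valP _).
by congr (limn (series _)); apply/funext => j; rewrite -[LHS]mulrA.
Qed.

Lemma l2_dot_ge x n : \sum_(0 <= j < n) (x j * x j) <= l2_dot x x.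
Proof.
apply: (@nondecreasing_cvgn_le _ (series (fun j => x j * x j))).
  by apply/nondecreasing_series => j _; rewrite -expr2 sqr_ge0.
exact: cvg_series_mul (l2valP _) (l2valP _).
Qed.

Lemma l2_dot_ge0 x : 0 <= l2_dot x x.
Proof. by have := l2_dot_ge x 0; rewrite big_nil. Qed.

Lemma l2_dot_eq0 x : l2_dot x x = 0 -> x = 0.
Proof.
move=> x0; apply/val_inj/funext => n /=.
have := l2_dot_ge x n.+1; rewrite x0 big_nat_recr//= => le0.
apply/eqP; rewrite -sqrf_eq0 expr2 eq_le -{2}expr2 sqr_ge0 andbT.
apply: le_trans le0; rewrite lerDr sumr_ge0// => j _.
by rewrite -expr2 sqr_ge0.
Qed.

End l2_dot.

Definition krein (R : realType) : Type := (l2 R * l2 R)%type.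

HB.instance Definition _ (R : realType) :=
  GRing.Lmodule.copy (krein R) (l2 R * l2 R)%type.

Definition krein_ip (R : realType) (z w : krein R) : R :=
  l2_dot z.1 w.1 - l2_dot z.2 w.2.

Section krein_norm.
Context {R : realType}.
Implicit Types (z w : krein R) (a : R).

Definition krein_norm z : R :=
  Num.sqrt (l2_norm z.1 ^+ 2 + l2_norm z.2 ^+ 2).

Let pip z w : R := l2_dot z.1 w.1 + l2_dot z.2 w.2.

Let pipC z w : pip z w = pip w z.
Proof. by rewrite /pip [X in X + _]l2_dotC [X in _ + X]l2_dotC. Qed.

Let pipDl z w u : pip (z + w) u = pip z u + pip w u.
Proof. by rewrite /pip /= !l2_dotDl addrACA. Qed.

Let pipZl a z w : pip (a *: z) w = a * pip z w.
Proof. by rewrite /pip /= !l2_dotZl mulrDr. Qed.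

Let pip_ge0 z : 0 <= pip z z.
Proof. by rewrite addr_ge0 ?l2_dot_ge0. Qed.

Let krein_normE z : krein_norm z = Num.sqrt (pip z z).
Proof. by rewrite /krein_norm !sqr_sqrtr ?l2_dot_ge0. Qed.

Let pip_eq0 z : pip z z = 0 -> z = 0.
Proof.
move=> /eqP; rewrite paddr_eq0 ?l2_dot_ge0// => /andP[/eqP + /eqP].
by case: z => x y /= /l2_dot_eq0 -> /l2_dot_eq0 ->.
Qed.

Let pip_cs z w : pip z w <= krein_norm z * krein_norm w.
Proof.
rewrite !krein_normE -sqrtrM//; apply: le_trans (ler_norm _) _.
rewrite -sqrtr_sqr ler_wsqrtr//.
have [z0|z0] := eqVneq (pip z z) 0.
  rewrite (pip_eq0 z0) (_ : pip 0 w = 0) ?expr0n ?mulr_ge0//.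
  by rewrite -(scale0r z) pipZl mul0r.
have {}z0 : 0 < pip z z by rewrite lt_def z0 pip_ge0.
have := pip_ge0 (pip z z *: w + (- pip z w) *: z).
rewrite (_ : pip _ _ = pip z z * (pip z z * pip w w - pip z w ^+ 2)).
  by rewrite pmulr_rge0// subr_ge0.
rewrite pipDl !pipZl [pip w (_ + _)]pipC [pip z (_ + _)]pipC !pipDl !pipZl.
rewrite [pip w z]pipC; ring.
Qed.

Let krein_normD z w : krein_norm (z + w) <= krein_norm z + krein_norm w.
Proof.
rewrite [leLHS]krein_normE.
rewrite -[leRHS]ger0_norm ?addr_ge0 ?sqrtr_ge0// -sqrtr_sqr ler_wsqrtr//.
rewrite pipDl [pip z _]pipC [pip w (_ + _)]pipC !pipDl [pip w z]pipC.
rewrite sqrrD 2!krein_normE !sqr_sqrtr// -addrA -[leRHS]addrA lerD2l.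
rewrite addrA lerD2r -mulr2n lerMn2r/= -2!krein_normE; exact: pip_cs.
Qed.

Let krein_normZ a z : krein_norm (a *: z) = `|a| * krein_norm z.
Proof.
rewrite !krein_normE pipZl pipC pipZl mulrA -expr2 sqrtrM ?sqr_ge0//.
by rewrite sqrtr_sqr.
Qed.

Let krein_norm_eq0 z : krein_norm z = 0 -> z = 0.
Proof.
rewrite krein_normE => /eqP; rewrite sqrtr_eq0 => le0.
by apply: pip_eq0; apply/eqP; rewrite eq_le le0 pip_ge0.
Qed.

HB.instance Definition _ :=
  Lmodule_isNormed.Build R (krein R) krein_normD krein_normZ krein_norm_eq0.

End krein_norm.

HB.instance Definition _ (R : realType) :=
  Measurable.copy (krein R) (g_sigma_algebraType (@open (krein R))).

Local Notation I01 := (`[0%R, 1%R]%classic : set _).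

Section graph_root_distribution.
Context {R : realType}.
Implicit Types (F : probability (krein R) R) (Z : R -> krein R).

(* F \x F is the joint law of two independent Z1, Z2 ~ F. *)
Definition graph_root_distribution F : Prop :=
  (F \x F)%E [set z | 0 <= krein_ip z.1 z.2 <= 1] = 1%E.

Definition square_integrable F : Prop :=
  ('E_F[(fun z : krein R => `|z| ^+ 2)%R] < +oo)%E.

(* Maps on [0, 1] are represented by functions on R, used only on [0, 1]. *)
Definition inverse_transform_sampling F Z : Prop :=
  measurable_fun (I01 : set R) Z /\
  forall A : set (krein R), measurable A ->
    lebesgue_measure (I01 `&` Z @^-1` A) = F A.

Definition graphon Z (s s' : R) : R := krein_ip (Z s) (Z s').

End graph_root_distribution.

Section cut_distance.
Context {R : realType}.
Implicit Types (h : R -> R) (W : R -> R -> R).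

Definition measure_preserving h : Prop :=
  [/\ measurable_fun (I01 : set R) h,
      set_fun I01 I01 h &
      forall A : set R, measurable A -> A `<=` I01 ->
        lebesgue_measure (I01 `&` h @^-1` A) = lebesgue_measure A].

Definition cut_norm W : \bar R :=
  ereal_sup [set r | exists S S' : set R,
    [/\ measurable S, S `<=` I01, measurable S', S' `<=` I01 &
     r = `| \int[lebesgue_measure \x lebesgue_measure]_(p in S `*` S')
             (W p.1 p.2)%:E |%E]].

Definition cut_distance W1 W2 : \bar R :=
  ereal_inf [set r | exists h1 h2 : R -> R,
    [/\ measure_preserving h1, measure_preserving h2 &
     r = cut_norm (fun s s' => W1 (h1 s) (h1 s') - W2 (h2 s) (h2 s'))]].

End cut_distance.

Section wasserstein.
Context {R : realType}.
Implicit Types F : probability (krein R) R.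

(* The product sigma-field on krein R * krein R is also the Borel one, because
   krein R is separable. *)
Definition coupling F1 F2 : set (probability (krein R * krein R)%type R) :=
  [set nu | forall A : set (krein R), measurable A ->
     nu (fst @^-1` A) = F1 A /\ nu (snd @^-1` A) = F2 A].

Definition wasserstein F1 F2 : \bar R :=
  ereal_inf [set 'E_nu[(fun p => `|p.1 - p.2|)%R] | nu in coupling F1 F2]%E.

End wasserstein.

(* Main.v *)
(** A coupling [nu] of [F1] and [F2] need not come from a pair of measure-preserving
    maps composed with [Z1] and [Z2], but it does approximately. Cut the separable
    space [krein R] into countably many Borel pieces [A i] of small diameter, and [0, 1]
    into consecutive intervals, one for each block [A i `*` A j], of length the
    [nu]-mass of the block. On such an interval let [h1] (resp. [h2]) be the quantile
    function of Lebesgue measure conditioned on the preimage of [A i] under [Z1]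
    (resp. of [A j] under [Z2]). Since [nu] has marginals [F1] and [F2], the pieces add up
    to measure-preserving maps, and [Z1 \o h1], [Z2 \o h2] are on average as close
    as [nu] requires, up to the diameter of the pieces. The cut norm is then bounded
    by integrating
      [|<z1, w1> - <z2, w2>| <= |z1 - z2| * |w1| + |z2| * |w1 - w2|]
    over the unit square. *)
Require Import Defs.
From mathcomp Require Import all_boot all_order all_algebra.
From mathcomp Require Import all_classical all_reals all_analysis.
From mathcomp Require Import measurable_realfun.
From mathcomp Require Import ring lra.

Import Order.TTheory GRing.Theory Num.Theory.
Import numFieldNormedType.Exports.
Local Open Scope classical_set_scope.
Local Open Scope ring_scope.

Local Notation I01 := (`[0%R, 1%R]%classic : set _).

(** * Geometry and measurability of the Krein space *)

Section krein_geometry.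
Context {R : realType}.
Implicit Types (x y : l2 R) (z w u : krein R).

(** The fundamental symmetry of the Krein space: it exchanges the indefinite product with a positive
    definite one and preserves the norm. *)
Let flip z : krein R := (z.1, - z.2).

Lemma l2_dotNl x y : l2_dot (- x) y = - l2_dot x y.
Proof. by rewrite -scaleN1r l2_dotZl mulN1r. Qed.

Lemma l2_dotNr x y : l2_dot x (- y) = - l2_dot x y.
Proof. by rewrite l2_dotC l2_dotNl l2_dotC. Qed.

Lemma l2_dotDr x y (v : l2 R) : l2_dot x (y + v) = l2_dot x y + l2_dot x v.
Proof. by rewrite l2_dotC l2_dotDl l2_dotC [l2_dot v x]l2_dotC. Qed.

Lemma krein_norm_sqr z : `|z| ^+ 2 = l2_dot z.1 z.1 + l2_dot z.2 z.2.
Proof.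
rewrite [`|z|]/(krein_norm z) sqr_sqrtr ?addr_ge0 ?sqr_ge0//.
by rewrite !sqr_sqrtr ?l2_dot_ge0.
Qed.

Lemma krein_ipC z w : krein_ip z w = krein_ip w z.
Proof. by rewrite /krein_ip l2_dotC [in X in _ - X]l2_dotC. Qed.

Lemma krein_ipBl z w u : krein_ip (z - w) u = krein_ip z u - krein_ip w u.
Proof. rewrite /krein_ip /= !l2_dotDl !l2_dotNl; ring. Qed.

Let krein_norm_flip z : `|flip z| = `|z|.
Proof.
apply/eqP; rewrite -(@eqrXn2 _ 2)// !krein_norm_sqr/=.
by rewrite l2_dotNl l2_dotNr opprK.
Qed.

(* The positive definite product of [z] with [flip w] is [krein_ip z w], and the
   triangle inequality for the norm is equivalent to Cauchy-Schwarz. *)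
Let krein_ip_le z w : krein_ip z w <= `|z| * `|w|.
Proof.
have := ler_normD z (flip w).
rewrite -(@ler_pXn2r _ 2) ?nnegrE ?addr_ge0// sqrrD krein_norm_flip.
rewrite !krein_norm_sqr /krein_ip /= !l2_dotDl !l2_dotDr !l2_dotNl !l2_dotNr.
rewrite [l2_dot w.1 z.1]l2_dotC [l2_dot w.2 z.2]l2_dotC.
rewrite -mulr_natr; lra.
Qed.

Lemma krein_cauchy_schwarz z w : `|krein_ip z w| <= `|z| * `|w|.
Proof.
(* The lower bound is the upper bound applied to [- z]. *)
rewrite ler_norml krein_ip_le andbT lerNl -(normrN z).
apply: le_trans (krein_ip_le _ _).
by rewrite -(sub0r z) krein_ipBl -(scale0r 0) /krein_ip /= !l2_dotZl !mul0r subrr sub0r.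
Qed.

Lemma krein_ipB_le z1 z2 w1 w2 :
  `|krein_ip z1 w1 - krein_ip z2 w2| <= `|z1 - z2| * `|w1| + `|z2| * `|w1 - w2|.
Proof.
rewrite (_ : _ - _ = krein_ip (z1 - z2) w1 + krein_ip z2 (w1 - w2)).
  apply: le_trans (ler_normD _ _) _.
  by apply: lerD; exact: krein_cauchy_schwarz.
by rewrite krein_ipBl [krein_ip z2 (_ - _)]krein_ipC krein_ipBl !(krein_ipC _ z2); ring.
Qed.

Lemma krein_coord_le z j : `|z.1 j| <= `|z| /\ `|z.2 j| <= `|z|.
Proof.
have le (x : l2 R) : `|x j| ^+ 2 <= l2_dot x x.
  apply: le_trans (l2_dot_ge x j.+1); rewrite real_normK ?num_real// big_nat_recr//=.
  by rewrite expr2 lerDr sumr_ge0// => i _; rewrite -expr2 sqr_ge0.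
split; rewrite -(@ler_pXn2r _ 2) ?nnegrE// krein_norm_sqr.
  by apply: le_trans (le _) _; rewrite lerDl l2_dot_ge0.
by apply: le_trans (le _) _; rewrite lerDr l2_dot_ge0.
Qed.

End krein_geometry.

Section krein_measurability.
Context {R : realType}.

Lemma open_krein_measurable (U : set (krein R)) : open U -> measurable U.
Proof. exact: sub_sigma_algebra. Qed.

(** The sigma-field is generated by the open sets, so continuity suffices; the norm and the
    coordinates are all 1-Lipschitz. *)
Lemma nonexpansive_krein_measurable (f : krein R -> R) :
  (forall z w, `|f z - f w| <= `|z - w|) -> measurable_fun setT f.
Proof.
move=> f1; have /continuousP cf : continuous f.
  move=> z; apply/(@cvgrPdist_lt _ _ _ _ (@nbhs_filter (krein R) z)) => e e0.
  apply: filterS (nbhsx_ballx z e e0) => w; rewrite -ball_normE /=.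
  exact: le_lt_trans.
apply: (measurability _ (RGenOpens.measurableE R)).
move=> _ [_ [a [b ->] <-]]; rewrite setTI; apply: open_krein_measurable.
exact/cf/interval_open.
Qed.

Lemma measurable_krein_norm : measurable_fun setT (fun z : krein R => `|z|).
Proof. by apply: nonexpansive_krein_measurable => z w; exact: ler_dist_dist. Qed.

Lemma measurable_krein_coord j :
  measurable_fun setT (fun z : krein R => z.1 j) /\
  measurable_fun setT (fun z : krein R => z.2 j).
Proof.
split; apply: nonexpansive_krein_measurable => z w.
  exact: (krein_coord_le (z - w) j).1.
exact: (krein_coord_le (z - w) j).2.
Qed.

Context d {T : measurableType d} (D : set T).

(** A pointwise limit of finite sums of products of coordinates. Arguing on real coordinates avoids
    any discussion of the sigma-field of a product of sequence spaces. *)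
Lemma measurable_l2_dot (x y : T -> l2 R) :
  (forall j, measurable_fun D (fun t => x t j)) ->
  (forall j, measurable_fun D (fun t => y t j)) ->
  measurable_fun D (fun t => l2_dot (x t) (y t)).
Proof.
move=> mx my.
apply: (@measurable_fun_cvg _ _ _ D (fun n t => \sum_(0 <= j < n) x t j * y t j)).
  by move=> n; apply: measurable_sum => j; exact: measurable_funM.
by move=> t Dt; exact: (cvg_series_mul (l2valP (x t)) (l2valP (y t))).
Qed.

Section two_maps.
Variables X Y : T -> krein R.
Hypotheses (mX : measurable_fun D X) (mY : measurable_fun D Y).

Let coord1 j (Z : T -> krein R) :
  measurable_fun D Z -> measurable_fun D (fun t => (Z t).1 j).
Proof. exact: (measurableT_comp (measurable_krein_coord j).1). Qed.

Let coord2 j (Z : T -> krein R) :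
  measurable_fun D Z -> measurable_fun D (fun t => (Z t).2 j).
Proof. exact: (measurableT_comp (measurable_krein_coord j).2). Qed.

Lemma measurable_krein_ip : measurable_fun D (fun t => krein_ip (X t) (Y t)).
Proof.
apply: measurable_funB; apply: measurable_l2_dot => j.
all: by [exact: coord1|exact: coord2].
Qed.

Lemma measurable_krein_dist : measurable_fun D (fun t => `|X t - Y t|).
Proof.
(* The squared distance is a sum of two coordinate series, so subtraction never has to be treated as
   a measurable map into the Krein space. *)
have mN : measurable_fun D (fun t => l2_dot (X t - Y t).1 (X t - Y t).1 +
    l2_dot (X t - Y t).2 (X t - Y t).2).
  apply: measurable_funD; apply: measurable_l2_dot => j;
    by apply: measurable_funB; by [exact: coord1|exact: coord2].
rewrite (_ : (fun t => _) = fun t => Num.sqrt (l2_dot (X t - Y t).1 (X t - Y t).1 +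
    l2_dot (X t - Y t).2 (X t - Y t).2)).
  exact: (measurableT_comp (continuous_measurable_fun (@sqrt_continuous R)) mN).
by apply/funext => t; rewrite -krein_norm_sqr sqrtr_sqr normr_id.
Qed.

End two_maps.

End krein_measurability.

(** * Separability of the Krein space and partitions into small pieces *)

Section krein_separability.
Context {R : realType}.

(** The default value of [nth] pads a list of rationals with zeros; these sequences form the
    countable dense set. *)
Let fin_seq (s : seq rat) (j : nat) : R := ratr (nth 0 s j).

Let fin_seqP s : fin_seq s \in @square_summable R.
Proof.
apply/square_summableP; rewrite -(is_cvg_series_restrict (size s)).
apply: (@is_cvg_near_cst _ _ 0); near=> n.
rewrite /= big_nat big1// => j /andP[sj _].
by rewrite /fin_seq nth_default// raddf0 expr0n.
Unshelve. all: by end_near. Qed.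

(** Beyond some [N] the squares of [x] sum to less than [e / 3]; the first [N] coordinates are
    approximated by rationals at a total cost of at most [e / 3]. *)
Let approx (x : l2 R) (e : R) : 0 < e ->
  exists s, l2_dot (x - L2 (fin_seqP s)) (x - L2 (fin_seqP s)) < e.
Proof.
move=> e0.
have cx : (series (fun j => x j * x j) : nat -> R) @ \oo --> l2_dot x x.
  exact: cvg_series_mul (l2valP x) (l2valP x).
have [N _ tailN] : \forall n \near \oo,
    l2_dot x x - e / 3 < series (fun j => x j * x j) n.
  by apply: (cvgr_gt _ cx); rewrite ltrBlDr ltrDl divr_gt0.
(* The share of the error allotted to each squared coordinate; [N.+1] keeps it meaningful when [N]
   is 0. *)
have d0 : 0 < e / 3 / N.+1%:R by rewrite !divr_gt0.
pose d := Num.sqrt (e / 3 / N.+1%:R).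
have dgt0 : 0 < d by rewrite sqrtr_gt0.
have q_ex j : {q : rat | `|x j - ratr q| < d}.
  apply: cid; have [|q] := @rat_in_itvoo R (x j - d) (x j + d).
    by rewrite ltrD2l gtrN.
  rewrite in_itv/= => /andP[q1 q2]; exists q.
  by rewrite ltr_norml ltrBrDl ltrBlDl; apply/andP; split; lra.
pose s := mkseq (fun j => sval (q_ex j)) N.
exists s; apply: (@le_lt_trans _ _ (e / 3 + e / 3)); last lra.
have := cvg_series_mul (l2valP (x - L2 (fin_seqP s))) (l2valP (x - L2 (fin_seqP s))).
move=> /limr_le; apply; near=> n.
have Nn : (N <= n)%N by near: n; exists N.
rewrite [leLHS]/series /= (@big_cat_nat _ _ _ N)//= lerD//.
  apply: (@le_trans _ _ (\sum_(0 <= j < N) e / 3 / N.+1%:R)).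
    rewrite big_nat [leRHS]big_nat; apply: ler_sum => j /andP[_ jN].
    rewrite [X in X * X](_ : _ = x j - fin_seq s j)//.
    rewrite /fin_seq nth_mkseq// -expr2 -[X in X <= _]real_normK ?num_real//.
    rewrite -[leRHS]sqr_sqrtr; last exact: ltW.
    rewrite ler_pXn2r ?nnegrE ?(ltW dgt0)//.
    exact/ltW/(svalP (q_ex j)).
  rewrite sumr_const_nat subn0 -[leLHS]mulr_natr -mulrA ler_piMr//.
    by rewrite divr_ge0// ltW.
  by rewrite [leLHS]mulrC ler_pdivrMr// mul1r ler_nat.
rewrite (eq_big_nat _ _ (F2 := fun j => x j * x j)); last first.
  move=> j /andP[Nj _]; rewrite [X in X * X](_ : _ = x j - fin_seq s j)//.
  by rewrite /fin_seq nth_default ?size_mkseq// raddf0 subr0.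
have := l2_dot_ge x n; rewrite (@big_cat_nat _ _ _ N)//=.
have := tailN N (leqnn N); rewrite /series/=; lra.
Unshelve. all: by end_near. Qed.

Lemma krein_separable : exists c : nat -> krein R,
  forall z (e : R), 0 < e -> exists n, `|z - c n| < e.
Proof.
pose c n : krein R := if unpickle n is Some s then
  (L2 (fin_seqP s.1), L2 (fin_seqP s.2)) else 0.
exists c => z e e0.
have e2 : 0 < e ^+ 2 / 2 by rewrite divr_gt0 ?exprn_gt0.
have [s1 h1] := approx z.1 _ e2; have [s2 h2] := approx z.2 _ e2.
exists (pickle (s1, s2)); rewrite /c pickleK/=.
rewrite -(@ltr_pXn2r _ 2) ?nnegrE ?(ltW e0)// krein_norm_sqr/=; lra.
Qed.

(** Balls around a dense sequence, each deprived of the earlier ones. The centre [c n] may thus fall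
    outside [A n]; only distances to it matter. *)
Lemma krein_small_partition (e : R) : 0 < e ->
  exists (A : (set (krein R))^nat) (c : nat -> krein R),
    [/\ forall n, measurable (A n), trivIset setT A, \bigcup_n A n = setT &
        forall n z, A n z -> `|z - c n| < e].
Proof.
move=> e0; have [c cP] := krein_separable.
pose B n : set (krein R) := [set z | `|z - c n| < e].
have mB n : measurable (B n).
  apply: open_krein_measurable; rewrite (_ : B n = ball (c n) e).
    exact: ball_open.
  by apply/seteqP; split => z; rewrite -ball_normE /B /= distrC.
exists (seqDU B), c; split.
- exact: seqDU_measurable.
- exact: trivIset_seqDU.
- rewrite -seqDU_bigcup_eq; apply/seteqP; split => // z _.
  by have [n zn] := cP z e e0; exists n.
- by move=> n z [].
Qed.

End krein_separability.

(** * Measure-preserving rearrangements of the unit interval *)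

Section measures_on_R.
Context {R : realType}.
Notation mu := (@lebesgue_measure R).

Lemma lebesgue_measure_I01 : mu (I01 : set R) = 1%E.
Proof. by rewrite lebesgue_measure_itv/= lte_fin ltr01 oppr0 adde0. Qed.

(** Open right rays are stable under intersection and generate the Borel sets; those starting at
    [- n%:R] exhaust the line and have finite measure, so the uniqueness theorem applies. *)
Lemma measure_eq_rays (m1 m2 : {measure set (measurableTypeR R) -> \bar R}) :
  (forall x, m1 `]x, +oo[%classic = m2 `]x, +oo[%classic) ->
  (forall x, m1 `]x, +oo[%classic < +oo)%E ->
  forall A, measurable A -> m1 A = m2 A.
Proof.
move=> m12 m1oo A mA.
apply: (@measure_unique _ R (measurableTypeR R) (@RGenOInfty.G R)
  (fun n => `](- n%:R), +oo[%classic)) => //.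
- exact: RGenOInfty.measurableE.
- move=> _ _ [x ->] [y ->]; exists (Num.max x y); apply/seteqP; split => z /=.
    by rewrite !in_itv/= !andbT gt_max => -[-> ->].
  by rewrite !in_itv/= !andbT gt_max => /andP[].
- by move=> n; exists (- n%:R).
- apply/seteqP; split => // x _; exists (Num.bound `|x|) => //=.
  rewrite in_itv/= andbT ltrNl; apply: le_lt_trans (ler_norm _) _.
  by rewrite normrN archi_boundP.
- by move=> _ [x ->].
Qed.

End measures_on_R.

Section quantile.
Context {R : realType}.
Notation mu := (@lebesgue_measure R).
Variables (B : set R) (r a : R).
Hypotheses (mB : measurable B) (BI : B `<=` I01) (r0 : 0 <= r).

Let finB (A : set R) : measurable A -> mu (B `&` A) \is a fin_num.
Proof.
move=> mA; rewrite ge0_fin_numE//; apply: (@le_lt_trans _ _ (mu (I01 : set R))).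
  apply: le_measure; rewrite ?inE; [exact: measurableI|exact: measurable_itv|].
  by move=> x [/BI].
by rewrite lebesgue_measure_I01 ltry.
Qed.

(** The tail function of [r] times Lebesgue measure on [B]; [p] is the total mass. *)
Let T x : R := r * fine (mu (B `&` `]x, +oo[)).
Let p : R := r * fine (mu B).

Let T_homo x y : x <= y -> T y <= T x.
Proof.
move=> xy; rewrite /T ler_wpM2l// fine_le ?finB//.
apply: le_measure; rewrite ?inE; [exact: measurableI..|].
by move=> z [Bz] /=; rewrite !in_itv/= !andbT => yz; split => //; exact: le_lt_trans yz.
Qed.

(** The measure with tail [T] has density at most [r]. This yields the right-continuity of [T] in
    quantitative form. *)
Let T_lip x y : x <= y -> T x <= T y + r * (y - x).
Proof.
move=> xy; rewrite /T -mulrDr ler_wpM2l// -lee_fin EFinD !fineK ?finB//.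
have -> : (y - x)%:E = mu (`]x, y]).
  by rewrite lebesgue_measure_itv/= lte_fin lt_neqAle xy andbT; case: eqVneq => // ->; rewrite subrr.
apply: le_trans (measureU2 _ _ _); [|exact: measurableI|exact: measurable_itv].
apply: le_measure; rewrite ?inE; [exact: measurableI| |].
  by apply: measurableU; [exact: measurableI|exact: measurable_itv].
move=> z [Bz] /=; rewrite !in_itv/= !andbT => xz.
by case: (leP z y) => yz; [right|left]; rewrite ?xz.
Qed.

Let T1 : T 1 = 0.
Proof.
rewrite /T (_ : _ `&` _ = set0) ?measure0 ?mulr0//.
rewrite -subset0 => x [/BI] /=; rewrite !in_itv/= andbT => /andP[_ x1].
by rewrite ltNge x1.
Qed.

Let Tlt0 x : x < 0 -> T x = p.
Proof.
move=> x0; rewrite /T (_ : _ `&` _ = B)//; apply/setIidPl => y /BI /=.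
by rewrite !in_itv/= andbT => /andP[y0 _]; exact: lt_le_trans y0.
Qed.

Let D : set R := `]a, a + p]%classic.

(** The points whose tail mass is at most the length remaining from [s] to [a + p]; the infimum is
    the quantile of level [s - a]. *)
Let E s : set R := [set x | T x <= a + p - s].
Let q s := inf (E s).

Let E_inf s : D s -> has_inf (E s).
Proof.
rewrite /D /= in_itv/= => /andP[as_ sp]; split.
  by exists 1; rewrite /E /= T1 subr_ge0.
exists 0 => x; rewrite /E /= => Ex; rewrite leNgt; apply/negP => /Tlt0 Tx.
move: Ex; rewrite Tx; lra.
Qed.

(* Galois connection of the quantile function with the tail; the infimum is
   attained because the tail is right-continuous. *)
Let q_gt s x : D s -> (x < q s) = (a + p - T x < s).
Proof.
move=> Ds; have iE := E_inf _ Ds; apply/idP/idP => [xq|].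
  rewrite ltNge; apply/negP => sT; move: xq; apply/negP; rewrite -leNgt.
  apply: ge_inf; first by case: iE.
  by rewrite /E /=; lra.
move=> Txs; rewrite ltNge; apply/negP => qx.
have : T x <= a + p - s; last by lra.
apply: le_trans (T_homo _ _ qx) _.
(* A point of [E s] within [e / (r + 1)] of the infimum changes [T] by at most [e]; dividing by
   [r + 1] covers the case [r = 0]. *)
apply/ler_addgt0Pr => e e0; have r1 : 0 < r + 1 by rewrite ltr_wpDl.
have [|y Ey yq] := @inf_adherent _ (E s) (e / (r + 1)) _ iE.
  by rewrite divr_gt0.
have qy : q s <= y by apply: ge_inf => //; case: iE.
apply: (le_trans (T_lip _ _ qy)); rewrite lerD//.
apply: (@le_trans _ _ (r * (e / (r + 1)))).
  by rewrite ler_wpM2l// lerBlDl ltW.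
by rewrite mulrCA ger_pMr// ler_pdivrMr// mul1r lerDl.
Qed.

Let q_I01 s : D s -> I01 (q s).
Proof.
move=> Ds; have iE := E_inf _ Ds; rewrite /= in_itv/=; apply/andP; split.
  rewrite leNgt; apply/negP => q0.
  have := q_gt _ (q s) Ds; rewrite ltxx Tlt0// addrK.
  by move: Ds; rewrite /D/= in_itv/= => /andP[->].
rewrite leNgt; apply/negP; rewrite q_gt// T1 subr0.
by move: Ds; rewrite /D/= in_itv/= => /andP[_]; rewrite leNgt => /negbTE ->.
Qed.

Let preimage_q x : D `&` q @^-1` `]x, +oo[%classic = `](a + p - T x), (a + p)]%classic.
Proof.
(* [T] equals [p] at negative points, so [x] is compared with a point that is both negative and at
   most [x]. *)
have Tp : T x <= p.
  by apply: le_trans (T_homo (Num.min x (- 1)) _ _) _;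
     rewrite ?Tlt0// ?ge_min ?lexx// gt_min ltrN10 orbT.
apply/seteqP; split => s /=; rewrite !in_itv/= ?andbT.
  by case=> Ds; rewrite q_gt// => ->; move: Ds; rewrite /D/= in_itv/= => /andP[].
move=> /andP[s1 s2]; have Ds : D s by rewrite /D /= in_itv/= s2 andbT; lra.
by split => //; rewrite q_gt.
Qed.

Let measurable_q : measurable_fun D q.
Proof.
move=> mD; apply: (measurability _ (RGenOInfty.measurableE R)) => //.
by move=> _ [_ [x ->] <-]; rewrite preimage_q; exact: measurable_itv.
Qed.

(** By [preimage_q] the image under [q] of Lebesgue measure on the interval has tail [T], like [r]
    times Lebesgue measure on [B]; equal tails force equal measures. The factor [r] lets several
    intervals share one set [B]. *)
Lemma quantile_function : exists q : R -> R,
  [/\ measurable_fun `]a, (a + r * fine (mu B))]%classic q,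
      forall s, a < s <= a + r * fine (mu B) -> I01 (q s) &
      forall A, measurable A ->
        mu (`]a, (a + r * fine (mu B))]%classic `&` q @^-1` A) =
        (r%:E * mu (B `&` A))%E].
Proof.
exists q; split=> //.
have mD : measurable D by exact: measurable_itv.
(* The push-forward takes a map on the whole line. The value 0 given to [q] outside [D] is harmless,
   since Lebesgue measure is restricted to [D]. *)
have mqD : measurable_fun setT (q \_ D) := (measurable_restrictT q mD).1 measurable_q.
pose m1 : {measure set (measurableTypeR R) -> \bar R} :=
  @measure_function_pushforward__canonical__measure_function_Measure _ _
    (measurableTypeR R) (measurableTypeR R) R (mrestr mu mD) (q \_ D) mqD.
pose m2 : {measure set (measurableTypeR R) -> \bar R} :=
  mscale (NngNum r0) (mrestr mu mB).
have m1E A : m1 A = mu (D `&` q @^-1` A).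
  rewrite /m1/= /pushforward/= /mrestr/= setIC; congr (mu _).
  by apply/seteqP; split => x [Dx]; rewrite /preimage/= /patch mem_set.
have m1T x : m1 `]x, +oo[%classic = (T x)%:E.
  rewrite m1E preimage_q lebesgue_measure_itv/= lte_fin ltrBlDr ltrDl.
  rewrite -EFinB opprB addrCA subrr addr0; case: ifPn => //.
  rewrite -leNgt => T0; congr EFin; apply/eqP; rewrite eq_le T0 andbT.
  by rewrite mulr_ge0// fine_ge0.
have m2E A : m2 A = (r%:E * mu (B `&` A))%E by rewrite setIC.
move=> A mA; rewrite -m1E -m2E; apply: measure_eq_rays mA => x.
  by rewrite m1T m2E /T EFinM fineK ?finB.
by rewrite m1T ltry.
Qed.

End quantile.

Lemma measure_partition d (T : measurableType d) (R : realType)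
    (m : {measure set T -> \bar R}) (E : (set T)^nat) (A : set T) :
  (forall n, measurable (E n)) -> trivIset setT E -> measurable A ->
  A `<=` \bigcup_n E n -> m A = (\sum_(n <oo) m (A `&` E n))%E.
Proof.
move=> mE tE mA AE; rewrite -(measure_semi_bigcup m).
- by rewrite -setI_bigcupr; congr (m _); apply/esym/setIidPl.
- by move=> n; exact: measurableI.
- exact: trivIset_setIl.
- by apply: bigcupT_measurable => n; exact: measurableI.
Qed.

Section consecutive_intervals.
Context {R : realType}.
Notation mu := (@lebesgue_measure R).
Variable p : R^nat.
Hypotheses (p0 : forall n, 0 <= p n) (p1 : (\sum_(n <oo) (p n)%:E = 1)%E).

(** Left-open, so that neighbours share no point. The union misses 0, and also 1 if the partial sums
    never reach 1, hence covers the unit interval only up to a null set. *)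
Definition consecutive_itv (n : nat) : set R := `](series p n), (series p n.+1)]%classic.

Let series_ge0 n : 0 <= series p n.
Proof. by rewrite /series/= sumr_ge0. Qed.

Let series_le m n : (m <= n)%N -> series p m <= series p n.
Proof. by move=> mn; apply/nondecreasing_series. Qed.

Let series_le1 n : series p n <= 1.
Proof.
rewrite -lee_fin -p1 /series/= -sumEFin.
by apply: nneseries_lim_ge => k _ _; rewrite lee_fin.
Qed.

Lemma measurable_consecutive_itv n : measurable (consecutive_itv n).
Proof. exact: measurable_itv. Qed.

Lemma consecutive_itv_sub n : consecutive_itv n `<=` I01.
Proof.
move=> x; rewrite /consecutive_itv /= !in_itv/= => /andP[x1 x2].
by rewrite (le_trans (series_ge0 n) (ltW x1)) (le_trans x2).
Qed.

Lemma trivIset_consecutive_itv : trivIset setT consecutive_itv.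
Proof.
move=> i j _ _ [x []]; rewrite /consecutive_itv /= !in_itv/=.
wlog ij : i j / (i <= j)%N => [wl|/andP[i1 i2] /andP[j1 j2]].
  by move=> xi xj; have [ij|/ltnW ji] := leqP i j; [exact: wl|apply/esym; exact: wl].
apply/eqP; rewrite eqn_leq ij/= leqNgt; apply/negP => /series_le ji.
by have := lt_le_trans j1 (le_trans i2 ji); rewrite ltxx.
Qed.

Lemma consecutive_itv_measure n : mu (consecutive_itv n) = (p n)%:E.
Proof.
rewrite /consecutive_itv lebesgue_measure_itv/= lte_fin -EFinB.
rewrite seriesS [p n + _]addrC ltrDl addrAC subrr add0r; case: ifPn => //.
by rewrite -leNgt => pn; congr EFin; apply/eqP; rewrite eq_le p0 pn.
Qed.

Lemma consecutive_itv_conull : mu (I01 `\` \bigcup_n consecutive_itv n) = 0%E.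
Proof.
have mb : measurable (\bigcup_n consecutive_itv n).
  by apply: bigcupT_measurable => n; exact: measurable_consecutive_itv.
have mI : measurable (I01 : set R) by exact: measurable_itv.
have I01E : mu (I01 : set R) = (mu (I01 `\` \bigcup_n consecutive_itv n) +
    mu (I01 `&` \bigcup_n consecutive_itv n))%E.
  exact: measureDI.
have bE : mu (I01 `&` \bigcup_n consecutive_itv n) = 1%E.
  rewrite setIidr; last by move=> x [n _]; exact: consecutive_itv_sub.
  transitivity (\sum_(n <oo) mu (consecutive_itv n))%E.
    apply: measure_semi_bigcup => //; first exact: measurable_consecutive_itv.
    exact: trivIset_consecutive_itv.
  by rewrite -p1; apply: eq_eseriesr => n _; exact: consecutive_itv_measure.
move: I01E; rewrite bE lebesgue_measure_I01; case: (mu _) => //= x [x1].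
by congr EFin; lra.
Qed.

End consecutive_intervals.

Section rearrangement.
Context {R : realType}.
Notation mu := (@lebesgue_measure R).
Variables (B : (set R)^nat) (k : nat -> nat) (p : R^nat).
Hypotheses (mB : forall j, measurable (B j)) (tB : trivIset setT B).
Hypothesis (BI : \bigcup_j B j = I01).
Hypotheses (p0 : forall n, 0 <= p n) (p1 : (\sum_(n <oo) (p n)%:E = 1)%E).
Hypothesis pB : forall j, (\sum_(n <oo | k n == j) (p n)%:E = mu (B j))%E.

Let subBI j : B j `<=` I01. Proof. by rewrite -BI => x Bx; exists j. Qed.

Let finB j : mu (B j) \is a fin_num.
Proof.
rewrite ge0_fin_numE//; apply: (@le_lt_trans _ _ (mu (I01 : set R))).
  by apply: le_measure; rewrite ?inE; [exact: mB|exact: measurable_itv|exact: subBI].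
by rewrite lebesgue_measure_I01 ltry.
Qed.

(* If [B (k n)] is null then the quotient is [0], and so is [p n]. *)
Let r n : R := p n / fine (mu (B (k n))).

Let r0 n : 0 <= r n. Proof. by rewrite divr_ge0// fine_ge0. Qed.

Let rB n : r n * fine (mu (B (k n))) = p n.
Proof.
rewrite /r; have [B0|B0] := eqVneq (fine (mu (B (k n)))) 0; last by rewrite divfK.
rewrite B0 mulr0; apply/eqP; rewrite eq_le p0/= -lee_fin -B0 fineK// -pB.
rewrite (nneseriesD1 (n := n))//; last by move=> i _; rewrite lee_fin.
by rewrite leeDl// nneseries_ge0// => i _ _; rewrite lee_fin.
Qed.

Let I n := consecutive_itv p n.

Let IE n : I n = `](series p n), (series p n + r n * fine (mu (B (k n))))]%classic.
Proof. by rewrite rB /I /consecutive_itv seriesS addrC. Qed.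

(** Quantile functions are glued: the [n]-th interval is spread over [B (k n)] with density [r n].
    By [pB] the densities landing on a non-null [B j] add up to 1, so Lebesgue measure is recovered
    there. *)
Lemma measure_preserving_rearrangement : exists h : R -> R,
  measure_preserving h /\
  forall n, mu (consecutive_itv p n `\` h @^-1` B (k n)) = 0%E.
Proof.
have mI n : measurable (I n) by exact: measurable_consecutive_itv.
have mbI : measurable (\bigcup_n I n) by exact: bigcupT_measurable.
have mI01 : measurable (I01 : set R) by exact: measurable_itv.
have bI01 : \bigcup_n I n `<=` I01.
  by move=> x [n _]; exact: (consecutive_itv_sub p p0 p1).
have /choice[q qP] n := quantile_function (B (k n)) (r n) (series p n) (mB _) (@subBI _) (r0 n).
have mq n : measurable_fun (I n) (q n) by rewrite IE; case: (qP n).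
have qI n s : I n s -> I01 (q n s).
  by rewrite IE /= in_itv/=; have [_ + _] := qP n; exact.
have qE n A : measurable A -> mu (I n `&` q n @^-1` A) = ((r n)%:E * mu (B (k n) `&` A))%E.
  by have [_ _ +] := qP n; rewrite -IE; exact.
pose h s := q (xget 0%N [set n | I n s]) s.
(* Off the intervals the value is 0, chosen inside the unit interval so that [h'] maps it to
   itself. *)
pose h' : R -> R := patch (cst (0 : R)) (\bigcup_n I n) h.
have hE n s : I n s -> h' s = q n s.
  move=> Is; rewrite /h' /patch mem_set; last by exists n.
  rewrite /h (_ : xget _ _ = n)//; apply: xget_unique => // m Im.
  by apply: (trivIset_consecutive_itv p p0 m n) => //; exists s.
have hI n A : I n `&` h' @^-1` A = I n `&` q n @^-1` A.
  by apply/seteqP; split => s [Is] /=; rewrite (hE _ _ Is).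
have mh : measurable_fun (I01 : set R) h'.
  rewrite (_ : I01 = \bigcup_n I n `|` I01 `\` \bigcup_n I n); last by rewrite setDUK.
  apply/measurable_funU => //; first exact: measurableD.
  split.
    apply/measurable_fun_bigcup => // n.
    by apply: (eq_measurable_fun (q n)) => // s; rewrite inE => /hE.
  apply: (eq_measurable_fun (cst (0 : R))) => // s; rewrite inE => -[_ sI].
  by rewrite /h' /patch memNset.
have h01 : set_fun (I01 : set R) (I01 : set R) h'.
  move=> s sI; rewrite /h'; have [[n _ Is]|sN] := pselect ((\bigcup_n I n) s).
    by rewrite -/(h' s) (hE _ _ Is); exact: qI Is.
  by rewrite /patch memNset//= in_itv/= lexx ler01.
have hsum A : measurable A -> mu (I01 `&` h' @^-1` A) =
    (\sum_(n <oo) ((r n)%:E * mu (B (k n) `&` A)))%E.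
  move=> mA; have mhA : measurable (I01 `&` h' @^-1` A) by exact: mh.
  have mIhA n : measurable (I n `&` h' @^-1` A) by rewrite hI; exact: mq.
  transitivity (mu (\bigcup_n (I n `&` h' @^-1` A))).
    rewrite (_ : I01 `&` _ = \bigcup_n (I n `&` h' @^-1` A) `|`
        (I01 `&` h' @^-1` A) `\` \bigcup_n I n).
      apply: measureU0; [exact: bigcupT_measurable|exact: measurableD|].
      apply: (subset_measure0 _ _ _ (consecutive_itv_conull p p0 p1)).
      - exact: measurableD.
      - exact: measurableD.
      - by move=> s [[]].
    rewrite -setI_bigcupl; apply/seteqP; split => s /=.
      by move=> [Is As]; have [|] := pselect ((\bigcup_n I n) s); [left|right].
    by move=> [[/bI01]|[]].
  transitivity (\sum_(n <oo) mu (I n `&` h' @^-1` A))%E.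
    apply: measure_semi_bigcup => //; last exact: bigcupT_measurable.
    by apply: trivIset_setIr; exact: trivIset_consecutive_itv.
  by apply: eq_eseriesr => n _; rewrite hI qE.
exists h'; split; last first.
  move=> n; rewrite (_ : _ `\` _ = I n `&` h' @^-1` (~` B (k n)))//.
  rewrite hI qE; last exact: measurableC.
  by rewrite setICr measure0 mule0.
split => // A mA AI.
(* Inside a single [B j] only the indices with [k n = j] contribute, each a fraction
   [p n / mu (B j)] of [mu C]. *)
have hB j C : measurable C -> C `<=` B j -> mu (I01 `&` h' @^-1` C) = mu C.
  move=> mC CB; rewrite hsum//.
  have kN n : k n != j -> mu (B (k n) `&` C) = 0%E.
    move=> kn; rewrite (_ : _ `&` _ = set0) ?measure0// -subset0 => s [Bs /CB Bjs].
    by move/eqP: kn; apply; apply: tB => //; exists s.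
  have kE n : k n == j -> mu (B (k n) `&` C) = mu C.
    by move=> /eqP ->; congr (mu _); exact/setIidPr.
  have finC : mu C \is a fin_num.
    rewrite ge0_fin_numE//; apply: (@le_lt_trans _ _ (mu (B j))).
      by apply: le_measure; rewrite ?inE; [exact: mC|exact: mB|exact: CB].
    by rewrite ltey_eq finB.
  (* A null [B j] is treated apart because the fractions divide by its measure. *)
  have [Bj0|Bj0] := eqVneq (mu (B j)) 0%E.
    have C0 : mu C = 0%E by exact: (@subset_measure0 _ _ _ mu _ _ mC (mB j) CB Bj0).
    rewrite C0 eseries0// => n _ _; have [/kE ->|/kN ->] := boolP (k n == j).
      by rewrite C0 mule0.
    by rewrite mule0.
  pose c := fine (mu C) / fine (mu (B j)).
  transitivity (\sum_(n <oo | k n == j) (c%:E * (p n)%:E))%E.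
    rewrite [RHS]eseries_mkcond; apply: eq_eseriesr => n _.
    case: ifPn => [kn|/kN ->]; last by rewrite mule0.
    rewrite kE// -[mu C]fineK// -!EFinM /r (eqP kn) /c; congr EFin; ring.
  rewrite nneseriesZl; last by move=> n _; rewrite lee_fin.
  rewrite pB -[mu (B j)]fineK// -EFinM /c divfK ?fineK//.
  by rewrite fine_eq0.
transitivity (\sum_(j <oo) mu (I01 `&` h' @^-1` (A `&` B j)))%E.
  transitivity (\sum_(j <oo) mu ((I01 `&` h' @^-1` A) `&` (I01 `&` h' @^-1` B j)))%E.
    apply: measure_partition.
    - by move=> j; exact: mh.
    - move=> i j _ _ [s [[_ Bi] [_ Bj]]]; apply: tB => //.
      by exists (h' s).
    - exact: mh.
    - move=> s [Is As]; have : I01 (h' s) by exact: h01.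
      by rewrite -{1}BI => -[j _ Bj]; exists j.
  apply: eq_eseriesr => j _; congr (mu _).
  by rewrite setIACA setIid preimage_setI.
transitivity (\sum_(j <oo) mu (A `&` B j))%E.
  apply: eq_eseriesr => j _; apply: (hB j); last exact: subIsetr.
  exact: measurableI.
by apply/esym/measure_partition => //; rewrite BI.
Qed.

End rearrangement.

(** * Realization of couplings *)

Section inverse_transform_sampling.
Context {R : realType}.
Notation mu := (@lebesgue_measure R).
Implicit Types (F : probability (krein R) R) (Z : R -> krein R).

Let mI01 : measurable (I01 : set R). Proof. exact: measurable_itv. Qed.

Lemma its_comp F Z (h : R -> R) : inverse_transform_sampling F Z ->
  measure_preserving h -> inverse_transform_sampling F (Z \o h).
Proof.
move=> [mZ ZF] [mh h01 hmu]; split=> [|A mA].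
  by apply: (measurable_comp mI01 _ mZ mh) => _ [s Is <-]; exact: h01.
rewrite -ZF// -[RHS]hmu; [|exact: (mZ mI01 _ mA)|by move=> s []].
congr (mu _); apply/seteqP; split => s [Is /=]; first by split=> //; split => //; exact: h01.
by case.
Qed.

Lemma its_integral F Z (f : krein R -> \bar R) : inverse_transform_sampling F Z ->
  measurable_fun setT f -> (forall z, 0 <= f z)%E ->
  (\int[mu]_(s in I01) f (Z s) = \int[F]_z f z)%E.
Proof.
move=> [mZ ZF] mf f0.
(* [F] is the push-forward of Lebesgue measure restricted to the unit interval by the extension of
   [Z] by 0, so the claim is a change of variables. *)
have mZ' := (measurable_restrictT Z mI01).1 mZ.
pose m : {measure set (measurableTypeR R) -> \bar R} := mrestr mu mI01.
have ZE s : I01 s -> (Z \_ I01) s = Z s by move=> Is; rewrite /patch mem_set.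
transitivity (\int[pushforward m (Z \_ I01)]_z f z)%E; last first.
  apply: eq_measure_integral => A mA _.
  transitivity (mu (I01 `&` Z @^-1` A)); last exact: ZF.
  change (mu ((Z \_ I01) @^-1` A `&` I01) = mu (I01 `&` Z @^-1` A)).
  rewrite [X in mu X]setIC; congr (mu _).
  by apply/seteqP; split => s [Is]; rewrite /preimage /= ZE.
rewrite ge0_integral_pushforward// preimage_setT.
transitivity (\int[m]_(s in I01) f (Z s))%E.
  by apply: eq_measure_integral => A mA AI /=; rewrite /m/= /mrestr setIidl.
rewrite [RHS](@ge0_negligible_integral _ _ _ m setT (~` I01)).
- by rewrite setTD setCK; apply: eq_integral => s; rewrite inE => Is /=; rewrite ZE.
- exact: measurableC.
- exact: measurableT.
- exact: (measurableT_comp mf).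
- by move=> s _; exact: f0.
- by rewrite /m /= /mrestr setICl measure0.
Qed.

End inverse_transform_sampling.

(** The partition [E] refines [G], so the blocks labelled [j] are those that fill [G j]. With blocks
    of a coupling this supplies the mass balance required by the rearrangement. *)
Lemma measure_class_sum d (T : measurableType d) (R : realType)
    (m : {measure set T -> \bar R}) (E G : (set T)^nat) (k : nat -> nat) (j : nat) :
  (forall n, measurable (E n)) -> trivIset setT E -> \bigcup_n E n = setT ->
  (forall i, measurable (G i)) -> trivIset setT G ->
  (forall n, E n `<=` G (k n)) ->
  (\sum_(n <oo | k n == j) m (E n) = m (G j))%E.
Proof.
move=> mE tE ET mG tG EG; rewrite (measure_partition _ _ _ m E (G j))//; last by rewrite ET.
rewrite eseries_mkcond; apply: eq_eseriesr => n _; case: ifPn => [/eqP <-|kn].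
  by congr (m _); apply/esym/setIidPr.
rewrite (_ : _ `&` _ = set0) ?measure0// -subset0 => x [Gj /EG Gk].
by move/eqP: kn; apply; apply: tG => //; exists x.
Qed.

Lemma ler_dist_three (K : numDomainType) (V : normedZmodType K) (x a b y : V) :
  `|x - y| <= `|x - a| + `|a - b| + `|b - y|.
Proof.
apply: le_trans (ler_distD b x y) _; rewrite lerD2r.
exact: ler_distD.
Qed.

Section pair_partition.
Context {d : measure_display} {T : measurableType d} (A : (set T)^nat).
Hypotheses (mA : forall n, measurable (A n)) (tA : trivIset setT A).
Hypothesis (AT : \bigcup_n A n = setT).

(* [pickle_inv n] is the pair coded by [n]; when [n] codes no pair the block is
   empty and the index is a dummy one. *)
Definition pair_index (n : nat) : nat * nat := odflt (0%N, 0%N) (pickle_inv n).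

Definition pair_block (n : nat) : set (T * T) :=
  if pickle_inv n is Some ij then A ij.1 `*` A ij.2 else set0.

Lemma measurable_pair_block n : measurable (pair_block n).
Proof. by rewrite /pair_block; case: pickle_inv => [ij|]; [exact: measurableX|exact: measurable0]. Qed.

Lemma pair_block_sub n :
  pair_block n `<=` A (pair_index n).1 `*` A (pair_index n).2.
Proof. by rewrite /pair_block /pair_index; case: pickle_inv => [ij|] x. Qed.

Lemma trivIset_pair_block : trivIset setT pair_block.
Proof.
move=> m n _ _ [x []]; rewrite /pair_block.
have := @pickle_invK (nat * nat)%type m; have := @pickle_invK (nat * nat)%type n.
case: pickle_inv => //= -[i j] <-; case: pickle_inv => //= -[i' j'] <- [/= a1 a2] [b1 b2].
by congr (pickle (_, _)); apply: tA => //; [exists x.1|exists x.2].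
Qed.

Lemma bigcup_pair_block : \bigcup_n pair_block n = setT.
Proof.
apply/seteqP; split => // x _.
have [i _ xi] : (\bigcup_n A n) x.1 by rewrite AT.
have [j _ xj] : (\bigcup_n A n) x.2 by rewrite AT.
by exists (pickle (i, j)) => //; rewrite /pair_block pickleK_inv.
Qed.

End pair_partition.

Section realization_of_couplings.
Context {R : realType}.
Notation mu := (@lebesgue_measure R).
Variables (F1 F2 : probability (krein R) R) (Z1 Z2 : R -> krein R).
Hypotheses (its1 : inverse_transform_sampling F1 Z1)
  (its2 : inverse_transform_sampling F2 Z2).
Variable nu : probability (krein R * krein R)%type R.
Hypothesis nuP : coupling F1 F2 nu.

Let mI01 : measurable (I01 : set R). Proof. exact: measurable_itv. Qed.

(** Both integrals are compared with the same step function, worth [|c (k n) - c (l n)|] on the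
    [n]-th interval and on the [n]-th block, which have equal mass. *)
Lemma coupling_realization (e : R) : 0 < e -> exists h1 h2 : R -> R,
  [/\ measure_preserving h1, measure_preserving h2 &
      (\int[mu]_(s in I01) `|Z1 (h1 s) - Z2 (h2 s)|%:E <=
       'E_nu[(fun p => `|p.1 - p.2|)%R] + e%:E)%E].
Proof.
(* Each of the two comparisons with the distance of centres costs [2 * d]. *)
move=> e0; pose d := e / 4; have d0 : 0 < d by rewrite divr_gt0.
have [A [c [mA tA AT Ac]]] := krein_small_partition _ d0.
pose C := pair_block A; pose k n := (pair_index n).1; pose l n := (pair_index n).2.
have mC n : measurable (C n) by exact: measurable_pair_block.
have tC : trivIset setT C by exact: trivIset_pair_block.
have CT : \bigcup_n C n = setT by exact: bigcup_pair_block.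
pose p n := fine (nu (C n)).
have pE n : (p n)%:E = nu (C n) by rewrite fineK// fin_num_measure.
have p0 n : 0 <= p n by rewrite fine_ge0.
have p1 : (\sum_(n <oo) (p n)%:E = 1)%E.
  rewrite (eq_eseriesr (g := nu \o C)); last by move=> n _; exact: pE.
  transitivity (nu (\bigcup_n C n)); last by rewrite CT; exact: probability_setT.
  by apply/esym/measure_semi_bigcup => //; exact: bigcupT_measurable.
have mB (Z : R -> krein R) F j : inverse_transform_sampling F Z -> measurable (I01 `&` Z @^-1` A j).
  by case=> mZ _; exact: mZ.
have tB (Z : R -> krein R) : trivIset setT (fun j => I01 `&` Z @^-1` A j).
  by move=> i j _ _ [s [[_ si] [_ sj]]]; apply: tA => //; exists (Z s).
have BI (Z : R -> krein R) : \bigcup_j (I01 `&` Z @^-1` A j) = I01.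
  apply/seteqP; split => [s [j _ []]//|s Is].
  have [j _ sj] : (\bigcup_n A n) (Z s) by rewrite AT.
  by exists j.
have [h1 [mh1 h1P]] : exists h : R -> R, measure_preserving h /\
    forall n, mu (consecutive_itv p n `\` h @^-1` (I01 `&` Z1 @^-1` A (k n))) = 0%E.
  apply: (measure_preserving_rearrangement (fun j => I01 `&` Z1 @^-1` A j) k p
    (fun j => mB _ _ j its1) (tB Z1) (BI Z1) p0 p1) => j.
  rewrite its1.2// -(nuP _ (mA j)).1.
  rewrite -(measure_class_sum _ _ _ nu C (fun i => fst @^-1` A i) k j)//.
  - by apply: eq_eseriesr => n _; exact: pE.
  - by move=> i; rewrite -[X in measurable X]setTI; exact: measurable_fst.
  - by move=> i i' _ _ [x [x1 x2]]; apply: tA => //; exists x.1.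
  - by move=> n x Cx; have [] := pair_block_sub _ _ _ Cx.
have [h2 [mh2 h2P]] : exists h : R -> R, measure_preserving h /\
    forall n, mu (consecutive_itv p n `\` h @^-1` (I01 `&` Z2 @^-1` A (l n))) = 0%E.
  apply: (measure_preserving_rearrangement (fun j => I01 `&` Z2 @^-1` A j) l p
    (fun j => mB _ _ j its2) (tB Z2) (BI Z2) p0 p1) => j.
  rewrite its2.2// -(nuP _ (mA j)).2.
  rewrite -(measure_class_sum _ _ _ nu C (fun i => snd @^-1` A i) l j)//.
  - by apply: eq_eseriesr => n _; exact: pE.
  - by move=> i; rewrite -[X in measurable X]setTI; exact: measurable_snd.
  - by move=> i i' _ _ [x [x1 x2]]; apply: tA => //; exists x.2.
  - by move=> n x Cx; have [] := pair_block_sub _ _ _ Cx.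
exists h1, h2; split => //.
have itsX1 := its_comp _ _ _ its1 mh1; have itsX2 := its_comp _ _ _ its2 mh2.
pose f s := `|Z1 (h1 s) - Z2 (h2 s)|.
have mf : measurable_fun (I01 : set R) f.
  by apply: measurable_krein_dist; [exact: itsX1.1|exact: itsX2.1].
pose I n := consecutive_itv p n.
have mI n : measurable (I n) by exact: measurable_consecutive_itv.
have mbI : measurable (\bigcup_n I n) by exact: bigcupT_measurable.
have bI01 : \bigcup_n I n `<=` I01.
  by move=> x [n _]; exact: (consecutive_itv_sub p p0 p1).
have mfI n : measurable_fun (I n) f.
  by apply: measurable_funS mf => //; exact: (consecutive_itv_sub p p0 p1).
have mg : measurable_fun setT (fun x : krein R * krein R => `|x.1 - x.2|).
  exact: measurable_krein_dist.
have small_ends (u v w : R) : u < d -> w < d -> u + v + w <= v + 2 * d.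
  by move=> ud wd; lra.
(* Outside the null set [N] both [h1] and [h2] land in the pieces prescribed for the interval, so
   each point is within [d] of its centre. *)
have f_le n : (\int[mu]_(s in I n) (f s)%:E <=
    (`|c (k n) - c (l n)| + 2 * d)%:E * (p n)%:E)%E.
  pose N := I n `\` h1 @^-1` (I01 `&` Z1 @^-1` A (k n)) `|`
            I n `\` h2 @^-1` (I01 `&` Z2 @^-1` A (l n)).
  have mh (h : R -> R) E : measure_preserving h -> measurable E ->
      measurable (I n `\` h @^-1` E).
    move=> [mh _ _] mE; rewrite (_ : _ `\` _ = I n `&` h @^-1` (~` E))//.
    by apply: (measurable_funS _ _ mh) => //;
      [exact: (consecutive_itv_sub p p0 p1)|exact: measurableC].
  have mN1 := mh _ _ mh1 (mB Z1 _ (k n) its1).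
  have mN2 := mh _ _ mh2 (mB Z2 _ (l n) its2).
  have mN : measurable N by exact: measurableU.
  have N0 : mu N = 0%E.
    transitivity (mu (I n `\` h1 @^-1` (I01 `&` Z1 @^-1` A (k n)))).
      exact: (@measureU0 _ _ _ mu _ _ mN1 mN2 (h2P n)).
    exact: h1P.
  rewrite (@ge0_negligible_integral _ _ _ mu (I n) N)//; last 3 first.
  - exact: mI.
  - by apply/measurable_EFinP; exact: mfI.
  - by move=> s _; rewrite lee_fin normr_ge0.
  have mIN : measurable (I n `\` N) by exact: measurableD.
  have b0 : 0 <= `|c (k n) - c (l n)| + 2 * d by rewrite addr_ge0// mulr_ge0// ltW.
  apply: (@le_trans _ _ (\int[mu]_(s in I n `\` N) (`|c (k n) - c (l n)| + 2 * d)%:E)%E).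
    apply: ge0_le_integral => //.
    - by move=> s _; rewrite lee_fin normr_ge0.
    - by apply/measurable_EFinP; apply: measurable_funS (mfI n).
    - move=> s [Is /not_orP[s1 s2]]; rewrite lee_fin.
      have [_ x1] : (I01 `&` Z1 @^-1` A (k n)) (h1 s) by apply: contrapT => ?; apply: s1.
      have [_ x2] : (I01 `&` Z2 @^-1` A (l n)) (h2 s) by apply: contrapT => ?; apply: s2.
      apply: le_trans (ler_dist_three _ _ _ (c (k n)) (c (l n)) _) _.
      rewrite [`|c (l n) - _|]distrC; apply: small_ends; exact: Ac.
  rewrite integral_cst//; apply: lee_wpmul2l; first by rewrite lee_fin.
  rewrite -(consecutive_itv_measure p p0).
  by apply: le_measure; rewrite ?inE; [exact: mIN|exact: mI|exact: subDsetl].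
(* On the block the coordinates are within [d] of the same centres, which costs another [2 * d] and
   brings the total to [e]. *)
have g_ge n : ((`|c (k n) - c (l n)| + 2 * d)%:E * (p n)%:E <=
    \int[nu]_(x in C n) (`|x.1 - x.2| + e)%:E)%E.
  rewrite pE -integral_cst//; apply: ge0_le_integral => //.
  - by move=> x _; rewrite lee_fin addr_ge0// mulr_ge0// ltW.
  - apply/measurable_EFinP/measurable_funD => //.
    exact: measurable_funS mg.
  - move=> x Cx; have [x1 x2] := pair_block_sub _ _ _ Cx; rewrite lee_fin.
    apply: le_trans (lerD (ler_dist_three _ _ _ x.1 x.2 _) (lexx _)) _.
    rewrite [`|c _ - x.1|]distrC.
    apply: le_trans (lerD (small_ends _ _ _ (Ac _ _ x1) (Ac _ _ x2)) (lexx _)) _.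
    by rewrite -addrA lerD2l /d; lra.
have -> : (\int[mu]_(s in I01) (f s)%:E = \int[mu]_(s in \bigcup_n I n) (f s)%:E)%E.
  rewrite (@ge0_negligible_integral _ _ _ mu I01 (I01 `\` \bigcup_n I n)).
  - by rewrite setDD setIidr.
  - exact: measurableD.
  - by [].
  - exact/measurable_EFinP.
  - by move=> s _; rewrite lee_fin normr_ge0.
  - exact: (consecutive_itv_conull p p0 p1).
rewrite ge0_integral_bigcup//; last 3 first.
- by apply/measurable_EFinP; exact: measurable_funS mf.
- by move=> s _; rewrite lee_fin normr_ge0.
- exact: trivIset_consecutive_itv.
apply: (@le_trans _ _ (\sum_(n <oo) \int[nu]_(x in C n) (`|x.1 - x.2| + e)%:E)%E).
  apply: lee_nneseries => [n _ _|n _]; last exact: le_trans (f_le n) (g_ge n).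
  by apply: integral_ge0 => s _; rewrite lee_fin normr_ge0.
rewrite -ge0_integral_bigcup//; last 2 first.
- by apply/measurable_EFinP/measurable_funD => //; rewrite CT.
- by move=> x _; rewrite lee_fin addr_ge0// ltW.
rewrite CT; under eq_integral do rewrite EFinD.
rewrite ge0_integralD//; last 2 first.
- exact/measurable_EFinP.
- by move=> x _; rewrite lee_fin ltW.
rewrite integral_cst// [X in (_ * X)%E](_ : _ = 1%E); last exact: probability_setT.
by rewrite mule1 unlock.
Qed.

End realization_of_couplings.

(** * Bound on the cut norm *)

Lemma ge0_integral_prodM d1 d2 (T1 : measurableType d1) (T2 : measurableType d2)
    (R : realType) (m1 : {sigma_finite_measure set T1 -> \bar R})
    (m2 : {sigma_finite_measure set T2 -> \bar R}) (f : T1 -> R) (g : T2 -> R) :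
  measurable_fun setT f -> measurable_fun setT g ->
  (forall x, 0 <= f x) -> (forall y, 0 <= g y) ->
  (\int[m1 \x m2]_z (f z.1 * g z.2)%:E =
   \int[m1]_x (f x)%:E * \int[m2]_y (g y)%:E)%E.
Proof.
move=> mf mg f0 g0; rewrite fubini_tonelli1//; last 2 first.
- apply/measurable_EFinP/measurable_funM; exact: measurableT_comp.
- by move=> z; rewrite lee_fin mulr_ge0.
transitivity (\int[m1]_x ((f x)%:E * \int[m2]_y (g y)%:E))%E.
  apply: eq_integral => x _; rewrite /fubini_F -ge0_integralZl//.
  - exact/measurable_EFinP.
  - by move=> y _; rewrite lee_fin.
  - by rewrite lee_fin.
rewrite ge0_integralZr//.
- exact/measurable_EFinP.
- by move=> x _; rewrite lee_fin.
- by apply: integral_ge0 => y _; rewrite lee_fin.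
Qed.

Section cut_norm_bound.
Context {R : realType}.
Notation mu := (@lebesgue_measure R).
Implicit Types X : R -> krein R.

Let dW X1 X2 (s s' : R) : R := krein_ip (X1 s) (X1 s') - krein_ip (X2 s) (X2 s').

(** The integrand is dominated by [phi], a sum of two products of one-variable functions. Enlarging
    the rectangle to the plane, Tonelli factors both integrals, with the mean distance as common
    factor. *)
Let rectangle_le X1 X2 (S S' : set R) :
  measurable_fun setT X1 -> measurable_fun setT X2 ->
  measurable S -> measurable S' ->
  (`| \int[mu \x mu]_(p in S `*` S') (dW X1 X2 p.1 p.2)%:E | <=
   (\int[mu]_s `|X1 s|%:E + \int[mu]_s `|X2 s|%:E) *
     \int[mu]_s `|X1 s - X2 s|%:E)%E.
Proof.
move=> mX1 mX2 mS mS'.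
have mX1f : measurable_fun setT (X1 \o fst : measurableTypeR R * measurableTypeR R -> _).
  exact: measurableT_comp mX1 measurable_fst.
have mX1s : measurable_fun setT (X1 \o snd : measurableTypeR R * measurableTypeR R -> _).
  exact: measurableT_comp mX1 measurable_snd.
have mX2f : measurable_fun setT (X2 \o fst : measurableTypeR R * measurableTypeR R -> _).
  exact: measurableT_comp mX2 measurable_fst.
have mX2s : measurable_fun setT (X2 \o snd : measurableTypeR R * measurableTypeR R -> _).
  exact: measurableT_comp mX2 measurable_snd.
have mn X : measurable_fun setT X -> measurable_fun setT (fun s => `|X s|).
  exact: measurableT_comp measurable_krein_norm.
have md := measurable_krein_dist _ _ _ _ mX1 mX2.
have mSS : measurable (S `*` S' : set (measurableTypeR R * measurableTypeR R)).
  exact: measurableX.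
have mW : measurable_fun setT
    (fun p : measurableTypeR R * measurableTypeR R => dW X1 X2 p.1 p.2).
  by apply: measurable_funB; apply: measurable_krein_ip.
pose phi (p : measurableTypeR R * measurableTypeR R) : R :=
  `|X1 p.1 - X2 p.1| * `|X1 p.2| + `|X2 p.1| * `|X1 p.2 - X2 p.2|.
have phi0 p : 0 <= phi p by rewrite addr_ge0// mulr_ge0.
have mphi1 : measurable_fun setT (fun p : measurableTypeR R * measurableTypeR R =>
    `|X1 p.1 - X2 p.1| * `|X1 p.2|).
  apply: measurable_funM; first exact: (measurable_krein_dist _ _ _ _ mX1f mX2f).
  exact: (measurableT_comp measurable_krein_norm mX1s).
have mphi2 : measurable_fun setT (fun p : measurableTypeR R * measurableTypeR R =>
    `|X2 p.1| * `|X1 p.2 - X2 p.2|).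
  apply: measurable_funM; last exact: (measurable_krein_dist _ _ _ _ mX1s mX2s).
  exact: (measurableT_comp measurable_krein_norm mX2f).
have mphi : measurable_fun setT phi by exact: measurable_funD.
apply: (@le_trans _ _ (\int[mu \x mu]_(p in S `*` S') (phi p)%:E)%E).
  apply: le_trans (le_abse_integral _ mSS _) _.
    by apply/measurable_EFinP; apply: measurable_funS mW.
  apply: ge0_le_integral => //.
  - by apply/measurable_EFinP/measurableT_comp => //; exact: measurable_funS mW.
  - by apply/measurable_EFinP; apply: measurable_funS mphi.
  - by move=> p _; rewrite lee_fin; exact: krein_ipB_le.
apply: (@le_trans _ _ (\int[mu \x mu]_p (phi p)%:E)%E).
  apply: ge0_subset_integral => //; first exact/measurable_EFinP.
  by move=> p _; rewrite lee_fin.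
under eq_integral do rewrite EFinD.
rewrite ge0_integralD//; [|exact/measurable_EFinP..].
rewrite (ge0_integral_prodM _ _ _ _ _ mu mu (fun s => `|X1 s - X2 s|) (fun s => `|X1 s|))//;
  last exact: mn.
rewrite (ge0_integral_prodM _ _ _ _ _ mu mu (fun s => `|X2 s|) (fun s => `|X1 s - X2 s|))//;
  last exact: mn.
rewrite [leRHS]ge0_muleDl; [|by apply: integral_ge0 => s _; rewrite lee_fin..].
by rewrite [X in (X + _ <= _)%E]muleC.
Qed.

Lemma cut_norm_krein_le X1 X2 :
  measurable_fun (I01 : set R) X1 -> measurable_fun (I01 : set R) X2 ->
  (cut_norm (fun s s' => (krein_ip (X1 s) (X1 s') - krein_ip (X2 s) (X2 s'))%R) <=
   (\int[mu]_(s in I01) `|X1 s|%:E + \int[mu]_(s in I01) `|X2 s|%:E) *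
     \int[mu]_(s in I01) `|X1 s - X2 s|%:E)%E.
Proof.
move=> mX1 mX2; apply: ge_ereal_sup => _ [S [S' [mS SI mS' SI' ->]]].
have mI01 : measurable (I01 : set R) by exact: measurable_itv.
(* Extension by 0 makes the maps measurable on the whole line and changes neither side of the
   bound. *)
pose Y X : R -> krein R := patch (cst 0) (I01 : set R) X.
have mY X : measurable_fun (I01 : set R) X -> measurable_fun setT (Y X).
  by move/(measurable_restrictT X mI01).1.
have YE X s : I01 s -> Y X s = X s by move=> Is; rewrite /Y /patch mem_set.
have Y0 X s : ~ I01 s -> Y X s = 0 by move=> Is; rewrite /Y /patch memNset.
have YI (f : krein R -> R) X : f 0 = 0 ->
    (\int[mu]_(s in I01) (f (X s))%:E = \int[mu]_s (f (Y X s))%:E)%E.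
  move=> f0; rewrite integral_mkcond; apply: eq_integral => s _; rewrite /= patchE.
  by case: ifPn => [/set_mem/(YE X) -> //|/negP Is]; rewrite Y0 ?f0// => /mem_set.
have -> : (\int[mu]_(s in I01) `|X1 s - X2 s|%:E =
    \int[mu]_s `|Y X1 s - Y X2 s|%:E)%E.
  rewrite integral_mkcond; apply: eq_integral => s _; rewrite /= patchE.
  case: ifPn => [/set_mem Is|/negP Is]; first by rewrite !YE.
  by rewrite !Y0 ?subr0 ?normr0// => /mem_set.
rewrite !(YI Num.norm) ?normr0//.
apply: le_trans (rectangle_le _ _ _ _ (mY _ mX1) (mY _ mX2) mS mS').
rewrite le_eqVlt; apply/orP; left; apply/eqP; congr (`| _ |%E).
apply: eq_integral => -[s s']; rewrite inE => -[/= /SI Is /SI' Is'].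
by rewrite /dW !YE.
Qed.

End cut_norm_bound.

(** * Existence of couplings, finiteness of the expected norm, and the final inequality *)

Section couplings.
Context {R : realType}.
Implicit Types F : probability (krein R) R.

(** Provides at least one coupling, which settles the case where both expected norms vanish. *)
Lemma product_coupling F1 F2 : coupling F1 F2 (F1 \x F2)%E.
Proof.
move=> A mA; split.
  rewrite (_ : fst @^-1` A = A `*` setT); last first.
    by apply/seteqP; split => [x /= Ax|x []].
  change ((F1 \x F2)%E (A `*` setT) = F1 A).
  by rewrite product_measure1E// [X in (_ * X)%E]probability_setT mule1.
rewrite (_ : snd @^-1` A = setT `*` A); last first.
  by apply/seteqP; split => [x /= Ax|x []].
change ((F1 \x F2)%E (setT `*` A) = F2 A).
by rewrite product_measure1E// [X in (X * _)%E]probability_setT mul1e.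
Qed.

Lemma square_integrable_norm F : square_integrable F ->
  ('E_F[(fun z : krein R => `|z|)%R] < +oo)%E.
Proof.
rewrite /square_integrable unlock => sqF.
have mN : measurable_fun setT (fun z : krein R => (`|z|%:E : \bar R)).
  by apply/measurable_EFinP; exact: measurable_krein_norm.
have mN2 : measurable_fun setT (fun z : krein R => ((`|z| ^+ 2)%:E : \bar R)).
  apply/measurable_EFinP; apply: measurable_funX; exact: measurable_krein_norm.
apply: (@le_lt_trans _ _ (\int[F]_z (1%:E + (`|z| ^+ 2)%:E))%E).
  apply: ge0_le_integral => //.
  - exact: emeasurable_funD.
  - move=> z _; rewrite -EFinD lee_fin.
    (* Expanding this square gives [|z| <= |z| ^+ 2 + 1 / 4]. *)
    have := sqr_ge0 (`|z| - 2^-1); rewrite sqrrB -mulr_natr; lra.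
rewrite ge0_integralD//.
rewrite integral_cst// [X in (_ * X)%E]probability_setT mule1.
exact: lte_add_pinfty (ltry _) sqF.
Qed.

End couplings.

Theorem lemma3p7 (R : realType) (F1 F2 : probability (krein R) R)
    (Z1 Z2 : R -> krein R)
    (grd1 : graph_root_distribution F1) (grd2 : graph_root_distribution F2)
    (sq1 : square_integrable F1) (sq2 : square_integrable F2)
    (its1 : inverse_transform_sampling F1 Z1)
    (its2 : inverse_transform_sampling F2 Z2) :
  (cut_distance (graphon Z1) (graphon Z2) <=
     ('E_F1[(fun z : krein R => `|z|)%R] + 'E_F2[(fun z : krein R => `|z|)%R])
     * wasserstein F1 F2)%E.
Proof.
set M := ('E_F1[_] + 'E_F2[_])%E.
have E0 F : (0 <= 'E_F[(fun z : krein R => `|z|)%R])%E by exact: expectation_ge0.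
have M0 : (0 <= M)%E by exact: adde_ge0.
have Mfin : M \is a fin_num.
  by rewrite ge0_fin_numE// lte_add_pinfty ?square_integrable_norm.
have bound nu e : coupling F1 F2 nu -> 0 < e ->
    (cut_distance (graphon Z1) (graphon Z2) <=
     M * ('E_nu[(fun p => `|p.1 - p.2|)%R] + e%:E))%E.
  move=> nuP e0.
  have [h1 [h2 [mh1 mh2 h12]]] := coupling_realization _ _ _ _ its1 its2 _ nuP _ e0.
  apply: (@le_trans _ _ (cut_norm (fun s s' =>
      graphon Z1 (h1 s) (h1 s') - graphon Z2 (h2 s) (h2 s')))).
    by apply: ereal_inf_lbound; exists h1, h2.
  (* Composing with a measure-preserving map keeps the law, so the integrals of the norms are the
     two expectations in [M]. *)
  have its1' := its_comp _ _ _ its1 mh1; have its2' := its_comp _ _ _ its2 mh2.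
  apply: le_trans (cut_norm_krein_le (Z1 \o h1) (Z2 \o h2) its1'.1 its2'.1) _.
  have mN : measurable_fun setT (fun z : krein R => (`|z|%:E : \bar R)).
    by apply/measurable_EFinP; exact: measurable_krein_norm.
  rewrite (its_integral _ _ _ its1' mN)// (its_integral _ _ _ its2' mN)//.
  rewrite [X in (X * _ <= _)%E](_ : _ = M); last by rewrite /M unlock.
  exact: lee_wpmul2l.
(* If [M] is 0, a single coupling already bounds the cut distance by 0. Otherwise [M] is positive
   and finite, and dividing by it allows passing to the infimum over couplings, then letting [e]
   tend to 0. *)
have [M_eq0|M_neq0] := eqVneq M 0%E.
  have := bound _ _ (product_coupling F1 F2) ltr01.
  by rewrite M_eq0 !mul0e.
have Mgt0 : 0 < fine M by rewrite fine_gt0// lt0e M_neq0 M0 ltey_eq Mfin.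
rewrite -[M in leRHS]fineK// -lee_pdivrMl//.
apply: le_ereal_inf_tmp => _ [nu nuP <-].
apply/lee_addgt0Pr => e e0; rewrite lee_pdivrMl// fineK//.
exact: bound.
Qed.
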